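(* Let $A$ be an arbitrary (not necessarily finite) set with $|A|\ge 3$. The completely join-irreducible elements of $\mathcal{E}$ are exactly the congruence lattices of the form $$E_{\kappa}:=\operatorname{Con}(A,\operatorname{End}\kappa)=\{\Delta,\kappa,\nabla\},$$ where $\kappa\in\operatorname{Eq}(A)\setminus\{\Delta,\nabla\}$ is an arbitrary equivalence relation. (In particular, $\operatorname{Con}(A,\operatorname{End}\kappa)=\{\Delta,\kappa,\nabla\}$ for every such $\kappa$.) Moreover, each completely join-irreducible element of $\mathcal{E}$ is an atom of $\mathcal{E}$, i.e. the lattice $\mathcal{E}$ is atomistic.
   Context: $\operatorname{Eq}(A)$ is the set of all equivalence relations on $A$; $\Delta=\{(x,x)\mid x\in A\}$ and $\nabla=A\times A$. A unary mapping $f\colon A\to A$ preserves $\kappa\in\operatorname{Eq}(A)$ if $(x,y)\in\kappa$ implies $(f(x),f(y))\in\kappa$ for all $x,y\in A$. $\operatorname{End}\kappa$ is the set of all $f\in A^A$ preserving $\kappa$. For $F\subseteq A^A$, $\operatorname{Con}(A,F)$ is the set of all $\kappa\in\operatorname{Eq}(A)$ preserved by every $f\in F$. $\mathcal{E}:=\{\operatorname{Con}(A,F)\mid F\subseteq A^A\}$, ordered by inclusion; it is a complete lattice whose meet is intersection, with least element $\{\Delta,\nabla\}$ and greatest element $\operatorname{Eq}(A)$. The join of $E_i\in\mathcal{E}$ $(i\in I)$ is $\operatorname{Con}(A,\bigcap_{\kappa\in \bigcup_i E_i}\operatorname{End}\kappa)$. An element is completely join-irreducible if it is not the join of the set of elements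 strictly below it (so the least element is not completely join-irreducible). An atom is an element covering the least element; a lattice is atomistic if every element different from the least element is a join of atoms. *)

(* Defs.v *)
From mathcomp Require Import all_boot all_order.
From mathcomp Require Import mathcomp_extra boolp classical_sets functions cardinality.

Set Implicit Arguments.
Unset Strict Implicit.
Unset Printing Implicit Defensive.

Local Open Scope classical_set_scope.

Section CongruenceLattices.
Variable A : Type.

Definition Delta : set (A * A) := diagonal.

Definition Nabla : set (A * A) := [set: A * A].

Definition Eqs : set (set (A * A)) :=
  [set kappa | [/\ forall x, kappa (x, x),
                   forall x y, kappa (x, y) -> kappa (y, x) &
                   forall x y z, kappa (x, y) -> kappa (y, z) -> kappa (x, z)]].

Definition preserves (f : A -> A) (kappa : set (A * A)) : Prop :=
  forall x y, kappa (x, y) -> kappa (f x, f y).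

Definition Endo (kappa : set (A * A)) : set (A -> A) :=
  [set f | preserves f kappa].

Definition Con (F : set (A -> A)) : set (set (A * A)) :=
  [set kappa | Eqs kappa /\ forall f, F f -> preserves f kappa].

Definition ConLattices : set (set (set (A * A))) :=
  [set E | exists F : set (A -> A), E = Con F].

Definition bottom : set (set (A * A)) := [set Delta; Nabla].

(* By [join_ub] and [join_le_ub] below, this is the least upper bound of [X]
   in [ConLattices] ordered by inclusion. *)
Definition join (X : set (set (set (A * A)))) : set (set (A * A)) :=
  Con (\bigcap_(kappa in \bigcup_(E in X) E) Endo kappa).

Definition completely_join_irreducible (E : set (set (A * A))) : Prop :=
  ConLattices E /\ E <> join [set F | ConLattices F /\ F `<` E].

Definition covers (E F : set (set (A * A))) : Prop :=
  F `<` E /\ ~ exists G, [/\ ConLattices G, F `<` G & G `<` E].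

Definition atom (E : set (set (A * A))) : Prop :=
  ConLattices E /\ covers E bottom.

Definition atomistic : Prop :=
  forall E, ConLattices E -> E <> bottom ->
    exists2 X : set (set (set (A * A))), X `<=` [set F | atom F] & E = join X.

Lemma ConLattices_join X : ConLattices (join X).
Proof. by exists (\bigcap_(kappa in \bigcup_(E in X) E) Endo kappa). Qed.

Lemma join_ub X E : X `<=` ConLattices -> X E -> E `<=` join X.
Proof.
move=> sX XE kappa Ek; split; last by move=> f; apply; exists E.
by have [F EF] := sX _ XE; move: Ek; rewrite EF => -[].
Qed.

Lemma join_le_ub X G :
  ConLattices G -> (forall E, X E -> E `<=` G) -> join X `<=` G.
Proof.
move=> [F ->] ubG kappa [eqk prk]; split=> // f Ff.
by apply: prk => mu [E XE Emu]; have [_] := ubG E XE mu Emu; apply.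
Qed.

Lemma ConLattices_bottom : ConLattices bottom.
Proof.
exists setT; apply/seteqP; split=> [kappa [] ->|kappa [[r s t] pr]].
- by split=> [|f _ x y]; [split=> // [x y z]; rewrite /Delta/diagonal/= => -> |
    rewrite /Delta/diagonal/= => ->].
- by split=> //; split.
have [[[a b] [ab kab]]|noab] :=
  pselect (exists p : A * A, p.1 <> p.2 /\ kappa p); last first.
  left; apply/seteqP; split=> -[x y] /=; rewrite /Delta/diagonal/=.
    by move=> kxy; apply: contrapT => xy; apply: noab; exists (x, y).
  by move=> ->; exact: r.
right; apply/seteqP; split=> // -[x y] _.
pose f z := if pselect (z = a) then x else y.
have fa : f a = x by rewrite /f; case: pselect.
have fb : f b = y.
  by rewrite /f; case: pselect => // ba; case: ab; rewrite ba.
by rewrite -fa -fb; exact: pr.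
Qed.

Lemma bottom_le E : ConLattices E -> bottom `<=` E.
Proof.
move=> [F ->] kappa [] ->; (split; last by
  move=> f _ x y; rewrite /Delta/diagonal/= => // ->).
- by split=> // x y z; rewrite /Delta/diagonal/= => ->.
- by split.
Qed.

End CongruenceLattices.

Arguments Delta A : clear implicits.
Arguments Nabla A : clear implicits.
Arguments Eqs A : clear implicits.
Arguments ConLattices A : clear implicits.
Arguments bottom A : clear implicits.

(* Main.v *)
Require Import Defs.
From mathcomp Require Import all_boot all_order.
From mathcomp Require Import mathcomp_extra boolp classical_sets functions cardinality.

(** Everything rests on the rigidity of [Con (Endo kappa)].  Two kinds of maps
    preserve an equivalence [kappa] for trivial reasons: those that are
    constant on every block, and those whose image lies in one block.  Suppose
    that [mu] is preserved by [Endo kappa].  If [mu] relates two points of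
    different blocks, the maps of the first kind send them to an arbitrary pair
    of points, so [mu] is [Nabla].  Otherwise [mu] is contained in [kappa]; if
    it relates two distinct points, the maps of the second kind send them to an
    arbitrary pair in [kappa], so [mu] is [kappa], and if not it is [Delta].

    The rest is order theory in the lattice.  [Con (Endo kappa)] is the least
    element of the lattice containing [kappa], so every [E] is the join of the
    [Con (Endo kappa)] for [kappa] in [E] outside the bottom element
    ([join_principal]).  A completely join-irreducible [E] is therefore one of
    these [Con (Endo kappa)].  Since [kappa] is the only element of
    [Con (Endo kappa)] outside the bottom, nothing but the bottom lies strictly
    below it ([lt_principal]): it is an atom and completely join-irreducible,
    and the decomposition of [E] above is a join of atoms. *)

Set Implicit Arguments.
Unset Strict Implicit.
Unset Printing Implicit Defensive.

Local Open Scope classical_set_scope.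
Local Open Scope card_scope.

Section Principal.
Variable A : Type.
Implicit Types (kappa mu : set (A * A)) (E : set (set (A * A))).

Lemma Con_Endo_refl kappa : Eqs A kappa -> Con (Endo kappa) kappa.
Proof. by move=> eqk; split. Qed.

(** The map sending the block of [a] to [x] and all other blocks to [y] is
    constant on blocks, and takes the pair [(a, b)] to [(x, y)]. *)
Lemma Con_Endo_separating kappa mu a b : Eqs A kappa -> Con (Endo kappa) mu ->
  mu (a, b) -> ~ kappa (a, b) -> mu = Nabla A.
Proof.
move=> [r s t] [_ pr] mab kab; apply/seteqP; split=> // -[x y] _.
pose f z := if pselect (kappa (a, z)) then x else y.
have fa : f a = x by rewrite /f; case: pselect => // -[]; exact: r.
have fb : f b = y by rewrite /f; case: pselect.
rewrite -fa -fb; apply: pr mab => u v kuv.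
have -> : f u = f v; last exact: r.
rewrite /f; case: pselect => [kau|nkau]; case: pselect => [kav|nkav] //.
  by case: nkav; exact: t kau kuv.
by case: nkau; exact: t kav (s _ _ kuv).
Qed.

(** The map sending [a] to [x] and everything else to [y] takes values in a
    single block as soon as [x] and [y] are related. *)
Lemma Con_Endo_collapsing kappa mu a b : Eqs A kappa -> Con (Endo kappa) mu ->
  mu (a, b) -> a <> b -> kappa `<=` mu.
Proof.
move=> [r s t] [_ pr] mab ab [x y] kxy.
pose f z := if pselect (z = a) then x else y.
have fa : f a = x by rewrite /f; case: pselect.
have fb : f b = y by rewrite /f; case: pselect => // ba; case: ab; rewrite ba.
rewrite -fa -fb; apply: pr mab => u v _.
by rewrite /f; do 2 case: pselect => ?; [exact: r| |exact: s|exact: r].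
Qed.

Lemma Con_EndoE kappa : Eqs A kappa ->
  Con (Endo kappa) = [set Delta A; kappa; Nabla A].
Proof.
move=> eqk; apply/seteqP; split=> [mu Cmu|mu].
  have [sub|/existsNP[[a b] /not_implyP[mab kab]]] := pselect (mu `<=` kappa);
    last by right; exact: Con_Endo_separating Cmu mab kab.
  left; have [->|muD] := pselect (mu = Delta A); [by left|right].
  apply/seteqP; split=> //.
  have [[mr _ _] _] := Cmu.
  have [[a [b [mab ab]]]|noab] :=
    pselect (exists a b, mu (a, b) /\ a <> b).
    exact: Con_Endo_collapsing Cmu mab ab.
  case: muD; apply/seteqP; split=> -[x y]; rewrite /Delta/diagonal/=.
    by move=> mxy; apply: contrapT => xy; apply: noab; exists x, y.
  by move=> ->; exact: mr.
have low : bottom A `<=` Con (Endo kappa) by apply: bottom_le; exists (Endo kappa).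
by move=> [[]|] ->; [apply: low; left|exact: Con_Endo_refl|apply: low; right].
Qed.

Lemma Con_Endo_le E kappa :
  ConLattices A E -> E kappa -> Con (Endo kappa) `<=` E.
Proof.
by move=> [F ->] [_ pr] mu [eqm prm]; split=> // f Ff; apply: prm; exact: pr.
Qed.

Lemma join_principal E : ConLattices A E ->
  E = join [set Con (Endo kappa) | kappa in E `\` bottom A].
Proof.
move=> CE; apply/seteqP; split; last first.
  by apply: join_le_ub => // _ [kappa [Ek _] <-]; exact: Con_Endo_le.
move=> kappa Ek.
have [bk|nbk] := pselect (bottom A kappa).
  by apply: bottom_le bk; exact: ConLattices_join.
have eqk : Eqs A kappa by case: CE Ek => F -> [].
apply: (join_ub _ _ (Con_Endo_refl eqk)); last by exists kappa.
by move=> _ [mu _ <-]; exists (Endo mu).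
Qed.

Lemma lt_principal E kappa : Eqs A kappa -> ConLattices A E ->
  E `<` Con (Endo kappa) -> E `<=` bottom A.
Proof.
move=> eqk CE [sub nsub] mu Emu.
have := sub _ Emu; rewrite Con_EndoE// => -[[->|muk]|->]; [by left| |by right].
by case: nsub; apply: Con_Endo_le => //; rewrite -muk.
Qed.

Lemma principal_atom kappa : Eqs A kappa -> ~ bottom A kappa ->
  atom (Con (Endo kappa)).
Proof.
move=> eqk nbk; have CE : ConLattices A (Con (Endo kappa)) by exists (Endo kappa).
split=> //; split.
  by split; [exact: bottom_le | move/(_ _ (Con_Endo_refl eqk))].
by move=> [G [CG [_ nGb] GE]]; apply: nGb; exact: lt_principal GE.
Qed.

Lemma principal_cji kappa : Eqs A kappa -> ~ bottom A kappa ->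
  completely_join_irreducible (Con (Endo kappa)).
Proof.
move=> eqk nbk; split; first by exists (Endo kappa).
move=> Ejoin; apply: nbk; have := Con_Endo_refl eqk; rewrite Ejoin.
apply: join_le_ub; first exact: ConLattices_bottom.
by move=> F [CF FE]; exact: lt_principal FE.
Qed.

(** If no [kappa] in [E] generated [E], all the joinands of [join_principal]
    would lie strictly below [E]. *)
Lemma cji_principal E : completely_join_irreducible E ->
  exists2 kappa, Eqs A kappa /\ ~ bottom A kappa & Con (Endo kappa) = E.
Proof.
move=> [CE nE]; apply: contrapT => nex; apply: nE.
apply/seteqP; split; last by apply: join_le_ub => // F [_ []].
rewrite {1}(join_principal CE); apply: join_le_ub; first exact: ConLattices_join.
move=> _ [kappa [Ek nbk] <-]; apply: join_ub; first by move=> F [].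
split; first by exists (Endo kappa).
split=> [|sub]; first exact: Con_Endo_le.
apply: nex; exists kappa; first by split=> //; case: CE Ek => F -> [].
by apply/seteqP; split=> //; exact: Con_Endo_le.
Qed.

End Principal.

Theorem theorem4p1 (A : Type) (cardA : `I_3 #<= [set: A]) :
  [/\ forall kappa : set (A * A),
        Eqs A kappa -> kappa <> Delta A -> kappa <> Nabla A ->
        Con (Endo kappa) = [set Delta A; kappa; Nabla A],
      [set E : set (set (A * A)) | completely_join_irreducible E] =
        [set Con (Endo kappa) | kappa in Eqs A `\` [set Delta A; Nabla A]],
      forall E : set (set (A * A)),
        completely_join_irreducible E -> atom E &
      atomistic A].
Proof.
split.
- by move=> kappa eqk _ _; exact: Con_EndoE.
- apply/seteqP; split=> [E /cji_principal[kappa ? <-]|_ [kappa [? ?] <-]].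
    by exists kappa.
  exact: principal_cji.
- by move=> E /cji_principal[kappa [? ?] <-]; exact: principal_atom.
- move=> E CE _; exists [set Con (Endo kappa) | kappa in E `\` bottom A].
    move=> _ [kappa [Ek nbk] <-]; apply: principal_atom nbk.
    by case: CE Ek => F -> [].
  exact: join_principal.
Qed.
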